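(* Let $\epsilon>0$. Every graph $G=(V,E)$ on $n$ vertices has an edge partition $E=E_0\cup E_1\cup\cdots\cup E_k$ such that $|E_0|\le \epsilon n^2$, $k\le 50\epsilon^{-2}$, and for $1\le i\le k$ the diameter of $E_i$ is at most $3$.
   Context: Graphs are finite and simple. The diameter of a connected graph is the maximum distance between two vertices ($\infty$ if disconnected). The diameter of an edge set $E'$ is the diameter of the graph with edge set $E'$ on the vertices covered by $E'$. *)

(* Defs.v *)
From HB Require Import structures.
From mathcomp Require Import all_boot all_order all_algebra.
From mathcomp Require Import reals.

Set Implicit Arguments.
Unset Strict Implicit.
Unset Printing Implicit Defensive.

Record sgraph (V : finType) := SGraph {
  adj :> rel V;
  adj_sym : symmetric adj;
  adj_irrefl : irreflexive adj
}.

Definition edges (V : finType) (G : sgraph V) : {set {set V}} :=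
  [set [set p.1; p.2] | p : V * V & adj G p.1 p.2].

Definition has_walk (V : finType) (G : sgraph V) (x y : V) (d : nat) : bool :=
  [exists p : d.-tuple V, path (adj G) x p && (last x p == y)].

(* The least length of a walk from x to y; a shortest walk has fewer than #|V|
   edges, so the search is bounded.  The value is the junk #|V| when y cannot
   be reached from x; diam below never uses it in that case. *)
Definition dist (V : finType) (G : sgraph V) (x y : V) : nat :=
  find (has_walk G x y) (iota 0 #|V|).

Definition connected (V : finType) (G : sgraph V) : bool :=
  [forall x : V, forall y : V, connect (adj G) x y].

(* None stands for an infinite diameter. *)
Definition diam (V : finType) (G : sgraph V) : option nat :=
  if connected G then Some (\max_(x : V) \max_(y : V) dist G x y) else None.

Definition diam_le (V : finType) (G : sgraph V) (d : nat) : bool :=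
  if diam G is Some m then m <= d else false.

Section EdgeSetGraph.
Variables (V : finType) (F : {set {set V}}).

Definition covered : finType := {x : V | x \in cover F}.

Definition edge_set_adj : rel covered :=
  [rel x y | (x != y) && ([set val x; val y] \in F)].

Lemma edge_set_adj_sym : symmetric edge_set_adj.
Proof. by move=> x y; rewrite /edge_set_adj /= eq_sym setUC. Qed.

Lemma edge_set_adj_irrefl : irreflexive edge_set_adj.
Proof. by move=> x; rewrite /edge_set_adj /= eqxx. Qed.

(* The graph with edge set F whose vertices are those covered by F. *)
Definition edge_set_graph : sgraph covered :=
  SGraph edge_set_adj_sym edge_set_adj_irrefl.

End EdgeSetGraph.

Lemma in_edges (V : finType) (G : sgraph V) (x y : V) :
  ([set x; y] \in edges G) = adj G x y.
Proof.
apply/imsetP/idP => [[[a b]] | Gxy]; last by exists (x, y); rewrite ?inE.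
rewrite inE /= => Gab eqE.
have nab : a != b by apply: contraTneq Gab => ->; rewrite adj_irrefl.
have Hx : x \in [set a; b] by rewrite -eqE set21.
have Hy : y \in [set a; b] by rewrite -eqE set22.
have Ha : a \in [set x; y] by rewrite eqE set21.
have Hb : b \in [set x; y] by rewrite eqE set22.
move: Hx Hy Ha Hb; rewrite !inE.
case/orP=> /eqP -> /orP[] /eqP -> //; rewrite ?orbb 1?adj_sym //.
  by move=> _; rewrite eq_sym (negPf nab).
by rewrite (negPf nab).
Qed.

Lemma has_walk_dist (V : finType) (G : sgraph V) (x y : V) :
  connect (adj G) x y -> has_walk G x y (dist G x y).
Proof.
case/connectP => p0 /shortenP[p Gp Up _] ->.
have ltp : size p < #|V|.
  by rewrite -[(size p).+1]/(size (x :: p)) -(card_uniqP Up) max_card.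
have hw : has (has_walk G x (last x p)) (iota 0 #|V|).
  apply/hasP; exists (size p); first by rewrite mem_iota.
  by apply/existsP; exists (in_tuple p); rewrite /= Gp eqxx.
have := nth_find 0 hw; rewrite nth_iota ?add0n //.
by rewrite has_find size_iota in hw.
Qed.

Lemma dist_min (V : finType) (G : sgraph V) (x y : V) (d : nat) :
  has_walk G x y d -> dist G x y <= d.
Proof.
move=> wd; have [ltd | led] := ltnP d #|V|; last first.
  by apply: leq_trans (find_size _ _) _; rewrite size_iota.
rewrite leqNgt; apply: contraL wd => /(before_find 0).
by rewrite nth_iota ?add0n // => ->.
Qed.

(* Main.v *)
(** For an edge uv, let B(u, v) be the set of edges ab with a adjacent to u and
    b adjacent to v.  It contains uv and all the edges at u or v, so any two
    vertices it covers are joined through u, v or the edge uv, and its diameter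
    is at most 3.  The pairs (a, b) summed over all uv count the closed walks of
    length 4, so for some uv the set B(u, v) is large: in a graph with t n^2
    edges, it has at least t^3 n^2 / 4 of them.  Remove such sets greedily while
    t > eps.  Each removal increases 4 / t^2 by at least 1, and 4 / t^2 stays
    below 4 / eps^2 until the last removal. *)
Require Import Defs.
From mathcomp Require Import all_boot all_order all_algebra.
From mathcomp Require Import reals.
From mathcomp Require Import ring lra.

Set Implicit Arguments.
Unset Strict Implicit.
Unset Printing Implicit Defensive.

Import Order.TTheory GRing.Theory Num.Theory.

(** Cauchy-Schwarz against the constant 1, obtained by summing [2 f(i) f(j) <= f(i)^2 + f(j)^2] over
    all ordered pairs. *)
Lemma sum_sqr_le (I : finType) (f : I -> nat) :
  (\sum_i f i) ^ 2 <= #|I| * \sum_i f i ^ 2.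
Proof.
rewrite -(leq_pmul2l (isT : 0 < 2)).
have -> : 2 * (#|I| * \sum_i f i ^ 2) = \sum_i \sum_j (f i ^ 2 + f j ^ 2).
  under [RHS]eq_bigr do rewrite big_split sum_nat_const /=.
  by rewrite big_split sum_nat_const /= -big_distrr /= addnn mul2n.
rewrite -mulnn big_distrlr big_distrr leq_sum //= => i _.
by rewrite big_distrr leq_sum //= => j _; rewrite nat_Cauchy.
Qed.

Lemma diam_le_walk (V : finType) (G : sgraph V) (d : nat) :
    (forall x y, exists p, [/\ path G x p, last x p = y & size p <= d]) ->
  diam_le G d.
Proof.
move=> walkG; rewrite /diam_le /diam; have -> : connected G.
  apply/forallP=> x; apply/forallP=> y; have [p [Gp <- _]] := walkG x y.
  by apply/connectP; exists p.
apply/bigmax_leqP=> x _; apply/bigmax_leqP=> y _.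
have [p [Gp lp sp]] := walkG x y; apply: leq_trans sp; apply: dist_min.
by apply/existsP; exists (in_tuple p); rewrite Gp lp eqxx.
Qed.

(** Lets walks be written in [V]: each vertex after the start is an end of an edge of [F], hence
    covered. *)
Lemma path_edge_set_graph (V : finType) (F : {set {set V}}) (x : covered F)
    (p : seq V) :
    path [rel a b | (a != b) && ([set a; b] \in F)] (val x) p ->
  exists2 q : seq (covered F), path (edge_set_graph F) x q & map val q = p.
Proof.
elim: p x => [|b p IHp] x /=; first by exists [::].
case/andP=> /andP[nxb Fxb] pathp.
have cb : b \in cover F by apply/bigcupP; exists [set val x; b]; rewrite ?set22.
have [q pq <-] := IHp (exist _ b cb) pathp.
by exists (exist _ b cb :: q); rewrite //= pq andbT /edge_set_adj /= Fxb andbT.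
Qed.

(** * Blocks around an edge: diameter and size *)

Section Blocks.
Variables (V : finType) (G : sgraph V).

(** When [u] and [v] are adjacent, these pairs are the closed walks [u, a, b, v, u] of length 4
    through the step from [v] to [u]. *)
Definition block_pairs (u v : V) : {set V * V} :=
  [set p | [&& G u p.1, G v p.2 & G p.1 p.2]].

Definition block (u v : V) : {set {set V}} :=
  [set [set p.1; p.2] | p in block_pairs u v].

Lemma block_sub_edges u v : block u v \subset edges G.
Proof.
apply/subsetP=> _ /imsetP[[a b] /[!inE]/= /and3P[_ _ Gab] ->].
by rewrite in_edges.
Qed.

Lemma mem_block u v a b :
  G u a -> G v b -> G a b -> [set a; b] \in block u v.
Proof.
by move=> Gua Gvb Gab; apply/imsetP; exists (a, b); rewrite // inE Gua Gvb.
Qed.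

Lemma diam_block u v : G u v -> diam_le (edge_set_graph (block u v)) 3.
Proof.
move=> Guv; have Gvu : G v u by rewrite adj_sym.
have neq a b : G a b -> a != b by apply: contraTneq => ->; rewrite adj_irrefl.
(* The edge [au] qualifies because its end [u] is itself a neighbour of [v]; symmetrically for
   [stepv]. *)
have stepu a : G u a -> (u != a) && ([set u; a] \in block u v).
  by move=> Gua; rewrite neq //= setUC mem_block // adj_sym.
have stepv a : G v a -> (v != a) && ([set v; a] \in block u v).
  by move=> Gva; rewrite neq //= mem_block.
have stepC a b : (a != b) && ([set a; b] \in block u v)
               = (b != a) && ([set b; a] \in block u v).
  by rewrite eq_sym setUC.
have nbr (x : covered (block u v)) : G u (val x) || G v (val x).
  case: x => x /= /bigcupP[_ /imsetP[[a b] /[!inE]/= /and3P[Gua Gvb _] ->]].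
  by rewrite !inE => /orP[] /eqP ->; rewrite ?Gua ?Gvb ?orbT.
apply: diam_le_walk => x y.
suff [p [pp lp sp]] : exists p : seq V,
    [/\ path [rel a b | (a != b) && ([set a; b] \in block u v)] (val x) p,
        last (val x) p = val y & size p <= 3].
  have [q pq Eq] := path_edge_set_graph pp; exists q; split => //.
    by apply: val_inj; rewrite -last_map Eq.
  by rewrite -(size_map val) Eq.
have [/orP[Gx|Gx] /orP[Gy|Gy]] := (nbr x, nbr y).
- by exists [:: u; val y]; rewrite /= stepC !stepu.
- by exists [:: u; v; val y]; rewrite /= stepC !stepu ?stepv.
- by exists [:: v; u; val y]; rewrite /= stepC !stepv ?stepu.
- by exists [:: v; val y]; rewrite /= stepC !stepv.
Qed.

(** The pairs that span a given edge [ab] all lie in the square of the set of its two ends, which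
    has at most 4 elements. *)
Lemma card_block_pairs u v : #|block_pairs u v| <= 4 * #|block u v|.
Proof.
rewrite -sum1_card (partition_big_imset (fun p => [set p.1; p.2])) /=.
rewrite mulnC -sum_nat_const leq_sum // => _ /imsetP[[a b] _ ->] /=.
rewrite sum1_card; apply: leq_trans (_ : #|setX [set a; b] [set a; b]| <= 4).
  apply/subset_leq_card/subsetP=> -[c d]; rewrite unfold_in /=.
  by case/andP=> _ /eqP <-; rewrite in_setX set21 set22.
by rewrite cardsX cards2; case: (a != b).
Qed.

(** The degree sum, that is, twice the number of edges. *)
Definition adj_count : nat := \sum_(p : V * V) G p.1 p.2.

Lemma card_edges_le : #|edges G| <= adj_count.
Proof.
apply: leq_trans (leq_imset_card _ _) _.
by rewrite -sum1_card big_mkcond leq_sum // => p _; rewrite inE.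
Qed.

Lemma adj_count_le : adj_count <= #|V| ^ 2.
Proof.
rewrite -mulnn -card_prod -sum1_card leq_sum // => p _.
exact: leq_b1.
Qed.

(** The sum on the right counts closed 4-walks, and so does the sum of the squared codegrees.
    Cauchy-Schwarz is applied twice: from degrees to codegrees, then from codegrees to their
    squares. *)
Lemma C4_count :
  adj_count ^ 4 <= #|V| ^ 4 * \sum_(p | G p.1 p.2) #|block_pairs p.1 p.2|.
Proof.
pose codeg (p : V * V) := \sum_u G u p.1 * G u p.2.
have le_codeg : adj_count ^ 2 <= #|V| * \sum_p codeg p.
  have -> : \sum_p codeg p = \sum_u (\sum_x G u x) ^ 2.
    rewrite exchange_big; apply: eq_bigr => u _ /=.
    by rewrite -mulnn big_distrlr pair_bigA.
  by rewrite /adj_count -(pair_bigA _ (fun x y => G x y : nat)) sum_sqr_le.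
have sum_codeg2 :
    \sum_p codeg p ^ 2 = \sum_(p | G p.1 p.2) #|block_pairs p.1 p.2|.
  (* The closed walk [u, x, w, y, u]. Fixing [x] and [y] leaves two common neighbours [u], [w];
     fixing the edge [ux] leaves a pair [(y, w)] of its block. *)
  pose walk4 u x y w : nat := [&& G u x, G u y, G x w & G y w].
  transitivity (\sum_u \sum_x \sum_y \sum_w walk4 u x y w).
    rewrite -(pair_bigA _ (fun x y => codeg (x, y) ^ 2)) /=.
    rewrite [RHS]exchange_big; apply: eq_bigr => x _ /=.
    rewrite [RHS]exchange_big; apply: eq_bigr => y _ /=.
    rewrite -mulnn big_distrlr; apply: eq_bigr => u _; apply: eq_bigr => w _.
    by rewrite /= !mulnb (adj_sym G w x) (adj_sym G w y) -andbA.
  rewrite pair_bigA [RHS]big_mkcond; apply: eq_bigr => -[u x] _ /=.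
  rewrite pair_bigA /walk4; case: (G u x) => /=; last by rewrite big1.
  rewrite -sum1_card [RHS]big_mkcond; apply: eq_bigr => -[y w] _.
  by rewrite inE; case: ifP.
apply: leq_trans (_ : (#|V| * \sum_p codeg p) ^ 2 <= _).
  by rewrite -[4]/(2 * 2) expnM leq_exp2r.
rewrite expnMn -[4]/(2 + 2) expnD -mulnA leq_mul2l -sum_codeg2.
apply/orP; right; apply: leq_trans (sum_sqr_le _) _.
by rewrite card_prod mulnn.
Qed.

(** The largest of the [adj_count] summands in [C4_count] is at least their average; cancelling one
    factor [adj_count] leaves a cube. *)
Lemma large_block : 0 < #|edges G| ->
  exists u v, G u v /\ #|edges G| ^ 3 <= 4 * #|V| ^ 4 * #|block u v|.
Proof.
move=> e_gt0; have S_gt0 : 0 < adj_count := leq_trans e_gt0 card_edges_le.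
have /card_gt0P[_ /imsetP[p0 Gp0 _]] := e_gt0.
rewrite inE in Gp0.
have [p Gp maxp] :=
  @arg_maxnP _ p0 (fun p => G p.1 p.2) (fun p => #|block_pairs p.1 p.2|) Gp0.
exists p.1, p.2; split=> //.
apply: leq_trans (_ : adj_count ^ 3 <= _); first by rewrite leq_exp2r ?card_edges_le.
apply: leq_trans (_ : #|V| ^ 4 * #|block_pairs p.1 p.2| <= _); last first.
  by rewrite -mulnA mulnCA leq_mul2l card_block_pairs orbT.
rewrite -(leq_pmul2l S_gt0) -expnS; apply: leq_trans C4_count _.
rewrite mulnCA leq_mul2l /adj_count; apply/orP; right.
rewrite big_distrl big_mkcond leq_sum //= => q _.
by case: ifP => // Gq; rewrite mul1n; exact: maxp.
Qed.

(** * Deletion of an edge set *)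

Variable F : {set {set V}}.

Definition del_adj : rel V := [rel x y | G x y && ([set x; y] \notin F)].

Lemma del_adj_sym : symmetric del_adj.
Proof. by move=> x y; rewrite /del_adj /= adj_sym setUC. Qed.

Lemma del_adj_irrefl : irreflexive del_adj.
Proof. by move=> x; rewrite /del_adj /= adj_irrefl. Qed.

Definition del_edges : sgraph V := SGraph del_adj_sym del_adj_irrefl.

Lemma edges_del : edges del_edges = edges G :\: F.
Proof.
apply/setP=> A; rewrite inE; apply/imsetP/andP => [[[a b]]|[nFA]].
  by rewrite inE /= => /andP[Gab nF] ->; rewrite nF in_edges.
case/imsetP=> -[a b]; rewrite inE /= => Gab defA; exists (a, b) => //.
by rewrite inE /= /del_adj /= Gab -defA.
Qed.

End Blocks.

(** * Greedy removal of blocks *)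

Local Open Scope ring_scope.

(** With [s = t - b], the increase is [4 b (t + s) / (t^2 s^2)], where [4 b >= t^3] and
    [t (t + s) >= s^2]. *)
Lemma inv_sqr_step (R : realFieldType) (t b : R) :
  0 < t -> t ^+ 3 <= 4 * b -> 0 < t - b -> 4 * t ^- 2 + 1 <= 4 * (t - b) ^- 2.
Proof.
move=> t_gt0 le_b; set s := t - b => s_gt0.
have le_st : s <= t by have := exprn_gt0 3 t_gt0; rewrite /s; lra.
rewrite -subr_ge0.
have -> : 4 * s ^- 2 - (4 * t ^- 2 + 1)
        = (4 * (t - s) * (t + s) - t ^+ 2 * s ^+ 2) / (t ^+ 2 * s ^+ 2).
  by field; rewrite !gt_eqF.
apply: divr_ge0; last by rewrite mulr_ge0 ?exprn_ge0 ?ltW.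
have -> : 4 * (t - s) = 4 * b by rewrite /s; ring.
rewrite subr_ge0; apply: le_trans (_ : t ^+ 3 * (t + s) <= _).
  have -> : t ^+ 3 * (t + s) = t ^+ 2 * (t * (t + s)) by ring.
  rewrite ler_wpM2l ?exprn_ge0 ?(ltW t_gt0) // expr2.
  by rewrite ler_pM ?(ltW s_gt0) // lerDr ltW.
by rewrite ler_wpM2r // addr_ge0 ?(ltW s_gt0) ?(ltW t_gt0).
Qed.

Section Greedy.
Variables (R : realType) (eps : R) (eps_gt0 : 0 < eps) (V : finType).

Definition edge_density (G : sgraph V) : R := #|edges G|%:R / #|V|%:R ^+ 2.

(** A potential bounding the number of removals still to come at density [t]. Above [eps] it exceeds
    [46 eps^-2], which pays for the last removal. *)
Definition num_pieces_bound (t : R) : R :=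
  if t <= eps then 0 else 50 * eps ^- 2 - 4 * t ^- 2.

Lemma num_pieces_bound_step (t b : R) :
    eps < t -> t <= 1 -> t ^+ 3 <= 4 * b ->
  num_pieces_bound (t - b) + 1 <= num_pieces_bound t.
Proof.
move=> lt_eps t_le1 le_b; have t_gt0 := lt_trans eps_gt0 lt_eps.
rewrite /num_pieces_bound [t <= eps]leNgt lt_eps /=.
case: (leP (t - b)) => [_|lt_eps_tb]; last first.
  have := inv_sqr_step t_gt0 le_b (lt_trans eps_gt0 lt_eps_tb); lra.
(* The last removal: the potential falls to 0 from at least [46 eps^-2], and [eps < t <= 1] makes
   this at least 1. *)
have : t ^- 2 <= eps ^- 2.
  by rewrite lef_pV2 ?posrE ?exprn_gt0 // lerXn2r ?nnegrE ?ltW.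
have : 1 <= eps ^- 2.
  by rewrite invf_ge1 ?exprn_gt0 // expr_le1 ?ltW // (lt_le_trans lt_eps).
lra.
Qed.

Lemma edge_density_le1 (G : sgraph V) : edge_density G <= 1.
Proof.
(* Division by 0 yields 0, so a graph without vertices has density 0. *)
rewrite /edge_density; have [->|V_gt0] := posnP #|V|.
  by rewrite expr0n /= invr0 mulr0.
rewrite ler_pdivrMr ?exprn_gt0 ?ltr0n // mul1r -natrX ler_nat.
exact: leq_trans (card_edges_le G) (adj_count_le G).
Qed.

Lemma edge_density_small (G : sgraph V) :
  edge_density G <= eps -> #|edges G|%:R <= eps * #|V|%:R ^+ 2.
Proof.
rewrite /edge_density; have [V0 _|V_gt0] := posnP #|V|.
  have := leq_trans (card_edges_le G) (adj_count_le G).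
  by rewrite V0 leqn0 => /eqP ->; rewrite expr0n mulr0.
by rewrite ler_pdivrMr ?exprn_gt0 ?ltr0n.
Qed.

(** Induction on the number of edges. Indexing the pieces by [nat] lets a removed block take index
    [k.+1] while the pieces of the remaining graph keep theirs. *)
Lemma greedy_decomposition (G : sgraph V) :
  exists (k : nat) (E : nat -> {set {set V}}),
    [/\ \bigcup_(i < k.+1) E i = edges G,
        forall i j, (i < j <= k)%N -> [disjoint E i & E j],
        #|E 0|%:R <= eps * #|V|%:R ^+ 2,
        k%:R <= num_pieces_bound (edge_density G)
      & forall i, (0 < i <= k)%N ->
          E i != set0 /\ diam_le (edge_set_graph (E i)) 3].
Proof.
have [m] := ubnP #|edges G|; elim: m G => // m IHm G lt_m.
have [le_eps|lt_eps] := leP (edge_density G) eps.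
  exists 0, (fun=> edges G); split=> [||||[]//].
  - by rewrite big_ord1.
  - by move=> i [|j]; rewrite ?ltn0 ?andbF.
  - exact: edge_density_small.
  - by rewrite /num_pieces_bound le_eps.
have : 0 < edge_density G := lt_trans eps_gt0 lt_eps.
rewrite {1}/edge_density; have [->|V_gt0] := posnP #|V|.
  by rewrite expr0n /= invr0 mulr0 ltxx.
have V2_gt0 : 0 < #|V|%:R ^+ 2 :> R by rewrite exprn_gt0 ?ltr0n.
rewrite pmulr_lgt0 ?invr_gt0 // ltr0n => /large_block[u [v [Guv le_B]]].
set B := block G u v in le_B.
have BG : B \subset edges G := block_sub_edges G u v.
(* The choice [a = v], [b = u] puts the edge [uv] in its own block, so the new piece is nonempty and
   the edge count drops. *)
have uvB : [set v; u] \in B by rewrite mem_block // adj_sym.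
have B_gt0 : (0 < #|B|)%N by apply/card_gt0P; exists [set v; u].
have cardD : (#|edges (del_edges G B)| + #|B| = #|edges G|)%N.
  by rewrite edges_del cardsD (setIidPr BG) subnK // subset_leq_card.
have [|k [E [unionE disjE smallE0 le_k diamE]]] := IHm (del_edges G B).
  by rewrite -ltnS (leq_trans _ lt_m) // ltnS -cardD -addn1 leq_add2l.
exists k.+1, (fun i => if i == k.+1 then B else E i).
have EB (i : nat) : (i < k.+1)%N -> (if i == k.+1 then B else E i) = E i.
  by move=> lt_ik; rewrite ltn_eqF.
split=> [|i j /andP[ltij]||| i /andP[i_gt0]].
- rewrite big_ord_recr /= eqxx.
  under eq_bigr => i _ do rewrite EB //.
  by rewrite unionE edges_del setUC -{1}(setIidPr BG) setID.
- rewrite leq_eqVlt => /predU1P[Ej|lt_jk]; last first.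
    by rewrite !EB ?disjE ?ltij // (ltn_trans ltij).
  have lt_ik : (i < k.+1)%N by rewrite -Ej.
  rewrite Ej eqxx EB //.
  (* Earlier pieces consist of edges that remain after [B] is deleted. *)
  have : E i \subset edges G :\: B.
    by rewrite -edges_del -unionE (bigcup_sup (Ordinal lt_ik)).
  by rewrite subsetD => /andP[].
- exact: smallE0.
- apply: le_trans (num_pieces_bound_step (b := #|B|%:R / #|V|%:R ^+ 2)
    lt_eps (edge_density_le1 G) _).
    rewrite -natr1 lerD2r (le_trans le_k) // le_eqVlt; apply/orP; left.
    apply/eqP; congr num_pieces_bound; rewrite /edge_density -cardD natrD.
    by rewrite mulrDl addrK.
  (* Multiplying [t^3 <= 4 b] by the sixth power of the number of vertices gives back the bound of
     [large_block]. *)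
  rewrite expr_div_n -exprM mulrA ler_pdivrMr ?exprn_gt0 ?ltr0n //.
  rewrite (_ : _ * _ = 4 * #|V|%:R ^+ 4 * #|B|%:R).
    by rewrite -!natrX -!natrM ler_nat.
  by field; rewrite pnatr_eq0 -lt0n.
- rewrite leq_eqVlt => /predU1P[->|lt_ik].
    by rewrite eqxx -card_gt0; split; last exact: diam_block.
  by rewrite EB //; apply: diamE; rewrite i_gt0.
Qed.

End Greedy.

Theorem theorem2p6 (R : realType) (eps : R) (eps_gt0 : 0 < eps)
    (n : nat) (V : finType) (card_V : #|V| = n) (G : sgraph V) :
  exists (k : nat) (E : 'I_k.+1 -> {set {set V}}),
    [/\ \bigcup_(i < k.+1) E i = edges G,
        forall i j : 'I_k.+1, i != j -> [disjoint E i & E j],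
        #|E ord0|%:R <= eps * n%:R ^+ 2,
        k%:R <= 50 * eps ^- 2
      & forall i : 'I_k.+1, i != ord0 ->
          E i != set0 /\ diam_le (edge_set_graph (E i)) 3].
Proof.
have [k [E [unionE disjE smallE0 le_k diamE]]] := greedy_decomposition eps_gt0 G.
exists k, (fun i => E i); split=> // [i j||| i i_neq0].
- rewrite neq_ltn => /orP[lt_ij|lt_ji]; first by rewrite disjE // lt_ij -ltnS /=.
  by rewrite disjoint_sym disjE // lt_ji -ltnS /=.
- by rewrite -card_V.
- have inv2_ge0 (x : R) : 0 <= x ^- 2 by rewrite invr_ge0 sqr_ge0.
  apply: le_trans le_k _; rewrite /num_pieces_bound.
  by case: ifP => _; have := inv2_ge0 eps; have := inv2_ge0 (edge_density R G); lra.
- by apply: diamE; rewrite lt0n -ltnS ltn_ord andbT.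
Qed.
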